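(* Let $G=(V,E)$ be a connected undirected graph on $n$ nodes with minimum nodal degree $\delta$, let $N_i$ denote the set of neighbours of node $i$, let $K>0$, and let $\bar w_1,\dots,\bar w_n\in\mathbb{R}$ satisfy $\sum_i\bar w_i=0$. Consider solutions $\vec\phi^t\in\mathbb{R}^n$, $t\ge0$, of $$\dot\phi_i=\bar w_i+\frac{K}{n}\sum_{k\in N_i}\sin(\phi_k-\phi_i),\qquad i=1,\dots,n,$$ with initial phases satisfying $\sum_{i=1}^n\phi_i^0=0$. Let $D_0=\max_i\phi_i^0-\min_i\phi_i^0$, $\mathcal{E}_0=\sum_{i=1}^n(\phi_i^0)^2$, $\sigma(\bar w)=\sqrt{\sum_{i=1}^n\bar w_i^2}$, and $$L=\frac{1}{1+\sum_{(k,l)\in E^c}\mathrm{dist}(k,l)},$$ where $E^c$ is the set of unordered pairs of distinct nodes that are not edges of $G$, and $\mathrm{dist}(k,l)$ is the number of edges in a shortest path between $k$ and $l$ in $G$. Suppose $D$ is a constant with $0<D_0\le D\le\frac{\pi}{2}$, that $\mathcal{E}_0<\frac34 D^2$, that $$K\ge\frac{\sigma(\bar w)\, D}{\sqrt{\mathcal{E}_0}\,L\,\sin D},\qquad(\ast)$$ and that $$K\ge\frac{n\,|\bar w_i-\bar w_j|}{2\delta\,\sin\!\Bigl(\frac D2-\sqrt{\mathcal{E}_0-\frac{D^2}{2}}\Bigr)}\quad\text{for all }1\le i,j\le n.$$ Then $D_t:=\max_i\phi_i^t-\min_i\phi_i^t\le D$ for all $t\ge0$ (so the set $\{\vec\phi\in\mathbb{R}^n:\max_{i,j}|\phi_i-\phi_j|\le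 D,\ \sum_i\phi_i=0\}$ is positively invariant for this solution), and the system achieves frequency synchronization, i.e. the solution approaches the set $\{\vec\phi:\dot\phi_i=0,\ 1\le i\le n\}$. Moreover, when $\mathcal{E}_0<\frac{D^2}{2}$, the same conclusion holds assuming only condition $(\ast)$ on $K$ (together with $0<D_0\le D\le\frac\pi2$).
   Context: This is the Kuramoto model in a frame rotating with the mean natural frequency: $\bar w_i=w_i-\frac1n\sum_k w_k$. Along solutions $\sum_i\phi_i^t$ is constant, hence $0$ for all $t$. Frequency synchronization means convergence of the solution to the set of equilibria of this system. *)

(* Defs.v *)
From HB Require Import structures.
From mathcomp Require Import all_boot all_order all_algebra.
From mathcomp Require Import all_classical all_reals all_analysis.
Set Implicit Arguments. Unset Strict Implicit. Unset Printing Implicit Defensive.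
Import Order.TTheory GRing.Theory Num.Theory.
Import numFieldNormedType.Exports.
Local Open Scope classical_set_scope.
Local Open Scope ring_scope.

Definition simple_graph n (e : rel 'I_n) : Prop :=
  symmetric e /\ irreflexive e.

Definition connected_graph n (e : rel 'I_n) : Prop :=
  forall i j : 'I_n, connect e i j.

Definition degree n (e : rel 'I_n) (i : 'I_n) : nat := #|[set j | e i j]|.
Definition min_degree n (e : rel 'I_n) : nat :=
  \big[minn/n]_(i : 'I_n) degree e i.

Definition walk_of_len n (e : rel 'I_n) (k l : 'I_n) (m : nat) : bool :=
  [exists p : m.-tuple 'I_n, path e k p && (last k p == l)].

(* graph distance: the least m such that a walk with m edges from k to l
   exists (such walks of minimal length are shortest paths); the search is
   over m < n, which suffices in a connected graph on n nodes (value n if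
   l is unreachable). *)
Definition gdist n (e : rel 'I_n) (k l : 'I_n) : nat :=
  find (walk_of_len e k l) (iota 0 n).

Definition L_const (R : realType) n (e : rel 'I_n) : R :=
  1 / (1 + \sum_(k : 'I_n) \sum_(l : 'I_n | (k < l)%N && ~~ e k l)
             (gdist e k l)%:R).

Definition kuramoto_rhs (R : realType) n (e : rel 'I_n) (K : R)
    (w : 'I_n -> R) (phi : 'I_n -> R) (i : 'I_n) : R :=
  w i + K / n%:R * \sum_(k : 'I_n | e i k) sin (phi k - phi i).

(* max_i x_i - min_i x_i = max_{i,j} (x_i - x_j) *)
Definition spread (R : realType) n (x : 'I_n -> R) : R :=
  \big[Num.max/0]_(i : 'I_n) \big[Num.max/0]_(j : 'I_n) (x i - x j).

Definition is_solution (R : realType) n (e : rel 'I_n) (K : R)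
    (w : 'I_n -> R) (phi : R -> 'I_n -> R) : Prop :=
  (forall i : 'I_n, (fun s => phi s i) x @[x --> (0:R)^'+] --> phi 0 i) /\
  (forall (t : R) (i : 'I_n), 0 < t ->
     is_derive t 1 (fun s => phi s i) (kuramoto_rhs e K w (phi t) i)).

Definition equilibria (R : realType) n (e : rel 'I_n) (K : R)
    (w : 'I_n -> R) : set ('I_n -> R) :=
  [set psi | forall i, kuramoto_rhs e K w psi i = 0].

Definition approaches (R : realType) n (phi : R -> 'I_n -> R)
    (S : set ('I_n -> R)) : Prop :=
  forall eps : R, 0 < eps -> exists T : R, forall t, T <= t ->
    exists2 psi, S psi & forall i, `|phi t i - psi i| < eps.

(* Main.v *)
(** Let S be the convex set of phases y with zero mean, spread at most D and
    energy sum y_i^2 at most E0. On the part of its boundary where the energy is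
    E0, the velocity field does not increase the energy: Cauchy-Schwarz bounds
    the drift by sigma sqrt(E0), while sin x >= x sin D / D and the
    path-counting estimate of the edge energy by L bound the dissipation.
    Where y_i - y_j = D, the energy bound keeps the neighbours of i and j close
    enough to the midpoint of y_i and y_j for the coupling to beat w_i - w_j
    (and is contradictory if E0 < D^2 / 2). Both inequalities may be equalities,
    so the invariance of S is obtained by comparison with the slightly growing
    sets (1 + eps exp(M t)) S. The system being a gradient flow, a bounded
    solution has velocity tending to 0, hence approaches the equilibria by
    compactness. *)

Require Import Defs.
From HB Require Import structures.
From mathcomp Require Import all_boot all_order all_algebra.
From mathcomp Require Import all_classical all_reals all_analysis.
From mathcomp Require Import ring lra.
Import Order.TTheory GRing.Theory Num.Theory.
Import numFieldNormedType.Exports.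
Local Open Scope classical_set_scope.
Local Open Scope ring_scope.
Set Implicit Arguments.
Unset Strict Implicit.
Unset Printing Implicit Defensive.

(** * Trigonometric inequalities *)

Section Trigonometry.
Variable R : realType.
Implicit Types a b p q s u v x y : R.

Lemma ler_sin :
  {in `[- (pi / 2), pi / 2 : R] &, {mono sin : x y / x <= y}}.
Proof. by move=> x y xp yp; rewrite !leNgt ltr_sin. Qed.

Lemma ler_cos : {in `[0, pi : R] &, {mono cos : x y /~ y <= x}}.
Proof. by move=> x y xp yp; rewrite !leNgt ltr_cos. Qed.

Lemma MVT_sin a b : a <= b ->
  exists2 c, a <= c <= b & sin b - sin a = cos c * (b - a).
Proof.
have d_sin x : x \in `]a, b[ -> is_derive x 1 (@sin R) (cos x).
  by move=> _; exact: is_derive_sin.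
move=> ab; have [|c] := MVT_segment ab d_sin.
  by apply: continuous_subspaceT => x; exact: continuous_sin.
by rewrite in_itv /= => cab ->; exists c.
Qed.

Lemma ler_dist_sin x y : `|sin x - sin y| <= `|x - y|.
Proof.
wlog xy : x y / x <= y.
  by move=> h; have [/h//|/ltW/h] := leP x y; rewrite distrC [leRHS]distrC.
have [c _ sin_xy] := MVT_sin xy.
rewrite distrC sin_xy normrM [leRHS]distrC ler_piMl// ler_norml.
by rewrite cos_geN1 cos_le1.
Qed.

Lemma mulr_cos_le_sin x : 0 <= x <= pi -> x * cos x <= sin x.
Proof.
move=> /andP[x0 xpi]; have [c /andP[c0 cx]] := MVT_sin x0.
rewrite sin0 !subr0 mulrC => ->; rewrite ler_wpM2l// ler_cos// in_itv /=; lra.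
Qed.

Lemma sin_chord x a : 0 <= x <= a -> a <= pi -> x * sin a <= a * sin x.
Proof.
move=> /andP[x0 xa] api.
have [b /andP[b0 bx]] := MVT_sin x0; have [c /andP[xc ca]] := MVT_sin xa.
rewrite sin0 !subr0 => sin_a sin_x.
have cos_cb : cos c <= cos b by rewrite ler_cos ?in_itv /=; lra.
have -> : sin a = sin x + cos c * (a - x) by rewrite -sin_a; ring.
have : 0 <= (cos b - cos c) * (x * (a - x)) by rewrite !mulr_ge0 ?subr_ge0.
by rewrite sin_x; lra.
Qed.

Lemma sqr_sin_chord x a : `|x| <= a -> a <= pi ->
  x ^+ 2 * sin a <= a * (x * sin x).
Proof.
wlog x0 : x / 0 <= x.
  move=> h; have [/h//|/ltW x0] := leP 0 x.
  by rewrite -normrN -sqrrN -[x * _]mulrNN -sinN; apply: h; rewrite oppr_ge0.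
rewrite ger0_norm// => xa api.
have x0a : 0 <= x <= a by rewrite x0.
by have := ler_wpM2l x0 (sin_chord x0a api); lra.
Qed.

Lemma cosB_sub_cosD p q : cos (p - q) - cos (p + q) = 2 * (sin p * sin q).
Proof. by rewrite cosB cosD; ring. Qed.

Lemma sin_add_sin x y :
  sin x + sin y = 2 * (sin ((x + y) / 2) * cos ((x - y) / 2)).
Proof.
have := sinD ((x + y) / 2) ((x - y) / 2).
have := sinB ((x + y) / 2) ((x - y) / 2).
have -> : (x + y) / 2 - (x - y) / 2 = y by field.
have -> : (x + y) / 2 + (x - y) / 2 = x by field.
by move=> -> ->; ring.
Qed.

Lemma sinB_add_sinD a x : sin (a - x) + sin (a + x) = 2 * (sin a * cos x).
Proof. by rewrite sinB sinD; ring. Qed.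

Lemma cos_sqr_ge_half x : 0 <= x <= pi / 4 -> 1 / 2 <= cos x ^+ 2.
Proof.
move=> /andP[x0 xpi]; have pi0 := pi_gt0 R.
have : 0 <= cos (x + x) by apply: cos_ge0_pihalf; lra.
by have := cos2Dsin2 x; rewrite cosD; lra.
Qed.

Lemma cos_ge_half x : 0 <= x <= pi / 4 -> 1 / 2 <= cos x.
Proof.
move=> xpi; apply: le_trans (cos_sqr_ge_half xpi) _; have pi0 := pi_gt0 R.
by rewrite expr2 ler_piMr ?cos_le1//; apply: cos_ge0_pihalf; lra.
Qed.

Lemma half_mulr_le_sinM p q : 0 <= p <= pi / 4 -> 0 <= q <= pi / 4 ->
  p * q / 2 <= sin p * sin q.
Proof.
move=> p_pi q_pi; have pi0 := pi_gt0 R.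
have [cp cq] := (cos_ge_half p_pi, cos_ge_half q_pi).
have cpq : 1 / 2 <= cos p * cos q.
  have cpq0 : 0 <= cos p * cos q by rewrite mulr_ge0//; lra.
  rewrite -ler_sqr ?nnegrE//.
  have := cos_sqr_ge_half p_pi; have := cos_sqr_ge_half q_pi.
  have half0 : 0 <= 1 / 2 :> R by lra.
  by rewrite exprMn => hq hp; have := ler_pM half0 half0 hp hq; lra.
apply: (@le_trans _ _ ((p * cos p) * (q * cos q))).
  have pq0 : 0 <= p * q by rewrite mulr_ge0//; lra.
  by have := ler_wpM2l pq0 cpq; lra.
by apply: ler_pM; rewrite ?mulr_ge0 ?mulr_cos_le_sin//; lra.
Qed.

Lemma cos_ge_1Bsqr_half x : 1 - x ^+ 2 / 2 <= cos x.
Proof.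
have := cosB_sub_cosD (x / 2) (x / 2); rewrite subrr cos0 -splitr => cosxE.
suff : sin (x / 2) ^+ 2 <= (x / 2) ^+ 2 by lra.
have := ler_dist_sin (x / 2) 0; rewrite sin0 !subr0.
by rewrite -ler_sqr ?nnegrE// !real_normK ?num_real.
Qed.

Lemma cos_le_1Bsqr_quarter x : 0 <= x <= pi / 2 -> cos x <= 1 - x ^+ 2 / 4.
Proof.
move=> x_pi; have := cosB_sub_cosD (x / 2) (x / 2); rewrite subrr cos0 -splitr.
have : x / 2 * (x / 2) / 2 <= sin (x / 2) * sin (x / 2).
  by apply: half_mulr_le_sinM; lra.
lra.
Qed.

Lemma cos_le_cosM s u v : 0 <= s <= pi / 4 ->
  2 * u ^+ 2 + v ^+ 2 <= s ^+ 2 -> cos s <= cos u * cos v.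
Proof.
wlog v0 : v / 0 <= v.
  move=> h; have [/h//|/ltW v0] := leP 0 v.
  by rewrite -[cos v]cosN -[v ^+ 2]sqrrN; apply: h; rewrite oppr_ge0.
move=> s_pi uvs; have pi0 := pi_gt0 R.
have vs : v <= s by rewrite -ler_sqr ?nnegrE; have := sqr_ge0 u; lra.
have cv0 : 0 <= cos v by apply: cos_ge0_pihalf; lra.
have cos_uv : (1 - u ^+ 2 / 2) * cos v <= cos u * cos v.
  by rewrite ler_wpM2r// cos_ge_1Bsqr_half.
have u2_cos : u ^+ 2 * cos v <= u ^+ 2 by rewrite ler_piMr ?sqr_ge0// cos_le1.
have := @half_mulr_le_sinM ((s + v) / 2) ((s - v) / 2).
have := cosB_sub_cosD ((s + v) / 2) ((s - v) / 2).
have -> : (s + v) / 2 - (s - v) / 2 = v by field.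
have -> : (s + v) / 2 + (s - v) / 2 = s by field.
have -> : (s + v) / 2 * ((s - v) / 2) / 2 = (s ^+ 2 - v ^+ 2) / 8 by field.
move=> cosB_vs sinM_ge.
have : (s ^+ 2 - v ^+ 2) / 8 <= sin ((s + v) / 2) * sin ((s - v) / 2).
  by apply: sinM_ge; lra.
lra.
Qed.

Lemma sinB_le_sinBM_cos a s u v : 0 <= s <= a -> a <= pi / 4 ->
  2 * u ^+ 2 + v ^+ 2 <= s ^+ 2 -> sin (a - s) <= sin (a - u) * cos v.
Proof.
move=> s_a a_pi uvs; have pi0 := pi_gt0 R.
have cos_suv : cos s <= cos u * cos v by apply: cos_le_cosM => //; lra.
have sin_a : 0 <= sin a by apply: sin_ge0_pi; lra.
have cos_a : 0 <= cos a by apply: cos_ge0_pihalf; lra.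
have /andP[us vs] : (`|u| <= s) && (`|v| <= s).
  have s0 : 0 <= s by case/andP: s_a.
  rewrite -!(@ler_sqr _ _ s) ?nnegrE ?normr_ge0// !real_normK ?num_real//.
  by have := sqr_ge0 u; have := sqr_ge0 v; lra.
have cos_v : 0 <= cos v.
  by rewrite -cos_norm cos_ge0_pihalf//; have := normr_ge0 v; lra.
have sin_uv : sin u * cos v <= sin s.
  have sin_s : 0 <= sin s by apply: sin_ge0_pi; lra.
  have [u0|/ltW u0] := leP 0 u.
    rewrite ger0_norm// in us.
    apply: (@le_trans _ _ (sin u)); last by rewrite ler_sin ?in_itv /=; lra.
    by rewrite ler_piMr ?cos_le1//; apply: sin_ge0_pi; lra.
  rewrite ler0_norm// in us.
  apply: le_trans sin_s; rewrite mulr_le0_ge0//.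
  by rewrite -[u]opprK sinN oppr_le0; apply: sin_ge0_pi; lra.
rewrite !sinB.
by have := ler_wpM2l sin_a cos_suv; have := ler_wpM2l cos_a sin_uv; lra.
Qed.

Lemma sinB_le_sinM_cos a s v : 0 <= s <= a -> a <= pi / 4 ->
  2 / 3 * v ^+ 2 <= s ^+ 2 -> sin (a - s) <= sin a * cos v.
Proof.
move=> s_a a_pi vs; have pi0 := pi_gt0 R; have pi4 := pihalf_lt2 R.
have sin_a : 0 <= sin a by apply: sin_ge0_pi; lra.
have sin_s : 0 <= sin s by apply: sin_ge0_pi; lra.
have sin_cos : sin a <= cos a.
  have -> : cos a = sin (pi / 2 - a).
    by rewrite sinB sin_pihalf cos_pihalf; ring.
  by rewrite ler_sin ?in_itv /=; lra.
suff cos_sub_cos : cos s - cos v <= sin s.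
  rewrite sinB; have := ler_wpM2l sin_a cos_sub_cos.
  by have := ler_wpM2r sin_s sin_cos; lra.
have cos_v := cos_ge_1Bsqr_half v.
have cos_s : cos s <= 1 - s ^+ 2 / 4 by apply: cos_le_1Bsqr_quarter; lra.
have half_s : s / 2 <= sin s.
  apply: le_trans (mulr_cos_le_sin _); last lra.
  by rewrite ler_wpM2l//; [lra | have := @cos_ge_half s; lra].
have : s ^+ 2 <= s by rewrite expr2 ler_piMr//; lra.
lra.
Qed.

End Trigonometry.

(** * Finite sums *)

Lemma ler_sum_uniq (R : numDomainType) (I : finType) (s : seq I) (f : I -> R) :
  uniq s -> (forall i, 0 <= f i) -> \sum_(i <- s) f i <= \sum_i f i.
Proof.
move=> us f0; rewrite big_uniq//= [leRHS](bigID (mem s)) /= lerDl.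
by apply: sumr_ge0 => i _; exact: f0.
Qed.

Lemma ler_sum_card (R : numDomainType) (I : finType) (f : I -> R) (b : R) :
  (forall i, f i <= b) -> \sum_i f i <= #|I|%:R * b.
Proof. by move=> f_le; rewrite mulr_natl -sumr_const ler_sum. Qed.

Lemma sum_sqr_crossE (R : comNzRingType) (I : finType) (x y : I -> R) :
  \sum_i \sum_j (x i * y j - x j * y i) ^+ 2 =
  2 * ((\sum_i x i ^+ 2) * (\sum_i y i ^+ 2) - (\sum_i x i * y i) ^+ 2).
Proof.
set A := \sum_i x i ^+ 2; set B := \sum_i y i ^+ 2; set C := \sum_i x i * y i.
have inner i : \sum_j (x i * y j - x j * y i) ^+ 2 =
    B * x i ^+ 2 - 2 * C * (x i * y i) + A * y i ^+ 2.
  have expand j : (x i * y j - x j * y i) ^+ 2 =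
      x i ^+ 2 * y j ^+ 2 - 2 * (x i * y i) * (x j * y j) + y i ^+ 2 * x j ^+ 2.
    by ring.
  under eq_bigr do rewrite expand.
  by rewrite big_split sumrB /= -!mulr_sumr -/A -/B -/C; ring.
under eq_bigr do rewrite inner.
by rewrite big_split sumrB /= -!mulr_sumr -/A -/B -/C; ring.
Qed.

Section Energy.
Variables (R : rcfType) (I : finType).
Implicit Types x y : I -> R.

Lemma cauchy_schwarz_sum x y :
  \sum_i x i * y i <=
  Num.sqrt (\sum_i x i ^+ 2) * Num.sqrt (\sum_i y i ^+ 2).
Proof.
rewrite -sqrtrM; last by apply: sumr_ge0 => i _; exact: sqr_ge0.
apply: le_trans (ler_norm _) _; rewrite -sqrtr_sqr ler_wsqrtr//.
rewrite -subr_ge0 -(pmulr_rge0 _ (ltr0Sn R 1)) -sum_sqr_crossE.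
by apply: sumr_ge0 => i _; apply: sumr_ge0 => j _; exact: sqr_ge0.
Qed.

Definition energy x : R := \sum_i x i ^+ 2.

Lemma norm_le_sqrt_energy x i E : energy x <= E -> `|x i| <= Num.sqrt E.
Proof.
move=> x_E; rewrite -sqrtr_sqr ler_wsqrtr//; apply: le_trans x_E.
rewrite /energy (bigD1 i) //= lerDl.
by apply: sumr_ge0 => j _; exact: sqr_ge0.
Qed.

Lemma energy_ge0 x : 0 <= energy x.
Proof. by apply: sumr_ge0 => i _; exact: sqr_ge0. Qed.

Lemma energy_le0 x i : energy x <= 0 -> x i = 0.
Proof.
move=> /(norm_le_sqrt_energy i); rewrite sqrtr0 normr_le0.
exact: eqP.
Qed.

Lemma energyZ c x : energy (fun i => c * x i) = c ^+ 2 * energy x.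
Proof. by rewrite /energy mulr_sumr; apply: eq_bigr => i _; rewrite exprMn. Qed.

Lemma sum_sqr_subE x : \sum_i x i = 0 ->
  \sum_i \sum_j (x i - x j) ^+ 2 = 2 * #|I|%:R * energy x.
Proof.
move=> x0; have := sum_sqr_crossE x (fun=> 1).
under eq_bigr do under eq_bigr do rewrite !mulr1.
under [X in _ - X ^+ 2]eq_bigr do rewrite mulr1.
by rewrite x0 expr1n sumr_const -/(energy x) => ->; ring.
Qed.

End Energy.

Lemma sum_ord_sym (R : comNzRingType) (n : nat) (f : 'I_n -> 'I_n -> R) :
  (forall i j, f i j = f j i) -> (forall i, f i i = 0) ->
  \sum_i \sum_j f i j = 2 * \sum_(i < n) \sum_(j < n | (i < j)%N) f i j.
Proof.
move=> fC f0.
have split_row (i : 'I_n) : \sum_j f i j =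
    \sum_(j < n | (i < j)%N) f i j + \sum_(j < n | (j < i)%N) f i j.
  rewrite (bigID (fun j : 'I_n => (i < j)%N)) /=; congr (_ + _).
  rewrite (bigD1 i) ?ltnn//= f0 add0r; apply: eq_bigl => j.
  by rewrite -leqNgt [RHS]ltn_neqAle andbC.
under eq_bigr do rewrite split_row.
rewrite big_split /= [X in _ + X](exchange_big_dep predT) //=.
under [X in _ + X]eq_bigr do under eq_bigr do rewrite fC.
by rewrite mulr_natl mulr2n.
Qed.

Lemma ler_spread (R : realType) (n : nat) (x : 'I_n -> R) i j :
  x i - x j <= spread x.
Proof.
apply: le_trans (le_bigmax 0 (fun j => x i - x j) j) _.
exact: (le_bigmax 0 (fun i => \big[Num.max/0]_j (x i - x j)) i).
Qed.

Lemma spread_le (R : realType) (n : nat) (x : 'I_n -> R) (D : R) : 0 <= D ->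
  (forall i j, x i - x j <= D) -> spread x <= D.
Proof.
by move=> D0 xD; apply: bigmax_le => // i _; apply: bigmax_le => // j _.
Qed.

Lemma ler_dist_spread (R : realType) (n : nat) (x : 'I_n -> R) i j :
  `|x i - x j| <= spread x.
Proof. by rewrite ler_norml ler_spread andbT lerNl opprB ler_spread. Qed.

Lemma energy_gt0 (R : realType) (n : nat) (x : 'I_n -> R) :
  0 < spread x -> 0 < energy x.
Proof.
rewrite !ltNge; apply: contra => Ex.
by apply: spread_le => // i j; rewrite !(energy_le0 _ Ex) subrr.
Qed.

(** * Sums over the edges of a graph *)

Definition edge_sum (R : nmodType) (I : finType) (e : rel I)
    (f : I -> I -> R) : R :=
  \sum_u \sum_(v | e u v) f u v.

Lemma edge_sum_by_parts (R : comNzRingType) (I : finType) (e : rel I)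
    (x : I -> R) (s : I -> I -> R) :
  symmetric e -> (forall u v, s v u = - s u v) ->
  2 * \sum_u x u * \sum_(v | e u v) s u v =
  edge_sum e (fun u v => (x u - x v) * s u v).
Proof.
move=> e_sym sN; set X := \sum_u _.
have X_out : X = edge_sum e (fun u v => x u * s u v).
  by apply: eq_bigr => u _; rewrite mulr_sumr.
have X_in : X = edge_sum e (fun u v => - (x v * s u v)).
  rewrite X_out /edge_sum (exchange_big_dep predT) //=; apply: eq_bigr => v _.
  by apply: eq_big => [u|u _]; [rewrite e_sym | rewrite [s u v]sN mulrN].
rewrite mulr_natl mulr2n {1}X_out X_in -big_split; apply: eq_bigr => u _ /=.
by rewrite -big_split; apply: eq_bigr => v _ /=; ring.
Qed.

Section PathEnergy.
Variables (R : realFieldType) (I : finType) (e : rel I).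
Hypothesis e_sym : symmetric e.

Fixpoint path_energy (y : I -> R) (u : I) (p : seq I) : R :=
  if p is v :: q then (y u - y v) ^+ 2 + path_energy y v q else 0.

Lemma path_energy_ge0 y u p : 0 <= path_energy y u p.
Proof. by elim: p u => //= v p IHp u; rewrite addr_ge0 ?sqr_ge0. Qed.

Lemma sqr_sub_last_le_path_energy y u p :
  (y u - y (last u p)) ^+ 2 <= (size p)%:R * path_energy y u p.
Proof.
elim: p u => [|v p IHp] u /=; first by rewrite subrr expr0n mul0r.
have := IHp v; have := path_energy_ge0 y v p.
have -> : y u - y (last v p) = (y u - y v) + (y v - y (last v p)) by ring.
set a := y u - y v; set b := y v - _; set S := path_energy y v p => S0 bS.
rewrite -natr1; set m : R := (size p)%:R in bS *.
have m0 : 0 <= m by exact: ler0n.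
(* AM-GM: [2 a b <= 2 sqrt (m a^2) sqrt S <= m a^2 + S] *)
suff : 2 * (a * b) <= m * a ^+ 2 + S by lra.
apply: le_trans (ler_norm _) _.
have mS0 : 0 <= m * a ^+ 2 + S by rewrite addr_ge0// mulr_ge0// sqr_ge0.
rewrite -ler_sqr ?nnegrE// real_normK ?num_real//.
have : 0 <= a ^+ 2 * (m * S - b ^+ 2) by rewrite mulr_ge0 ?subr_ge0// sqr_ge0.
by have := sqr_ge0 (m * a ^+ 2 - S); lra.
Qed.

Lemma path_energy_le_seq y u p : path e u p ->
  2 * path_energy y u p <=
  \sum_(v <- u :: p) \sum_(w <- u :: p | e v w) (y v - y w) ^+ 2.
Proof.
elim: p u => [|v p IHp] u /=.
  by rewrite mulr0 => _; do 2!apply: sumr_ge0 => ? _; exact: sqr_ge0.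
move=> /andP[euv ep]; rewrite big_cons.
have from_u : (y u - y v) ^+ 2 <=
    \sum_(w <- u :: v :: p | e u w) (y u - y w) ^+ 2.
  rewrite big_cons; case: ifP => _; rewrite big_cons euv.
    rewrite addrCA lerDl addr_ge0 ?sqr_ge0 ?sumr_ge0// => ? _.
    exact: sqr_ge0.
  by rewrite lerDl sumr_ge0// => ? _; exact: sqr_ge0.
have from_p : (y u - y v) ^+ 2 +
    \sum_(w <- v :: p) \sum_(z <- v :: p | e w z) (y w - y z) ^+ 2 <=
    \sum_(w <- v :: p) \sum_(z <- u :: v :: p | e w z) (y w - y z) ^+ 2.
  rewrite big_cons [leRHS]big_cons addrA lerD//.
    by rewrite [leRHS]big_cons e_sym euv lerD2r -[leRHS]sqrrN opprB.
  apply: ler_sum => w _; rewrite [leRHS]big_cons; case: ifP => // _.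
  by rewrite lerDr sqr_ge0.
by have := IHp _ ep; lra.
Qed.

Lemma path_energy_le_edge_sum y u p : path e u p -> uniq (u :: p) ->
  2 * path_energy y u p <= edge_sum e (fun v w => (y v - y w) ^+ 2).
Proof.
move=> ep up; apply: le_trans (path_energy_le_seq y ep) _.
apply: (@le_trans _ _ (\sum_(v <- u :: p) \sum_(w | e v w) (y v - y w) ^+ 2)).
  apply: ler_sum => v _; rewrite big_mkcond [leRHS]big_mkcond.
  by apply: ler_sum_uniq => // w; case: ifP => // _; exact: sqr_ge0.
by apply: ler_sum_uniq => // v; apply: sumr_ge0 => w _; exact: sqr_ge0.
Qed.

End PathEnergy.

Section GraphDistance.
Variables (n : nat) (e : rel 'I_n).
Hypothesis e_conn : connected_graph e.

Lemma uniq_path_gdist k l : exists p,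
  [/\ path e k p, last k p = l, uniq (k :: p) & (size p <= gdist e k l)%N].
Proof.
have [found|not_found] := boolP (has (walk_of_len e k l) (iota 0 n)).
  have gdist_lt : (gdist e k l < n)%N.
    by move: found; rewrite has_find size_iota.
  have := nth_find 0 found; rewrite nth_iota// add0n.
  move=> /existsP[p /andP[ep /eqP]].
  case/shortenP: ep => q q_path uq sub_qp lq; exists q; split => //.
  rewrite -[gdist e k l](size_tuple p); apply: uniq_leq_size => //.
  by case/andP: uq.
rewrite /gdist (hasNfind not_found) size_iota.
have /connectP[p ep lp] := e_conn k l.
case/shortenP: ep lp => q q_path uq _ ->; exists q; split => //.
have := max_card (mem (k :: q)).
by rewrite (card_uniqP uq) /= card_ord => /ltnW.
Qed.

Variable R : realType.
Implicit Types y : 'I_n -> R.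

Lemma L_const_gt0 : 0 < L_const R e.
Proof.
rewrite /L_const div1r invr_gt0 ltr_pwDl// sumr_ge0// => k _.
by apply: sumr_ge0 => l _; exact: ler0n.
Qed.

Hypothesis e_simple : simple_graph e.

Lemma sqr_sub_le_gdist y k l :
  (y k - y l) ^+ 2 <=
  (gdist e k l)%:R * (edge_sum e (fun u v => (y u - y v) ^+ 2) / 2).
Proof.
have [p [ep <- up p_le]] := uniq_path_gdist k l.
apply: le_trans (sqr_sub_last_le_path_energy y k p) _.
apply: ler_pM; rewrite ?path_energy_ge0 ?ler_nat//.
by have := path_energy_le_edge_sum e_simple.1 y ep up; lra.
Qed.

Lemma energy_le_edge_sum y : \sum_i y i = 0 ->
  2 * n%:R * L_const R e * energy y <=
  edge_sum e (fun u v => (y u - y v) ^+ 2).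
Proof.
case: e_simple => e_sym e_irr y0; set Q := edge_sum _ _.
set S : R := \sum_(k < n) \sum_(l < n | (k < l)%N && ~~ e k l) (gdist e k l)%:R.
pose f k l := if e k l then 0 else (y k - y l) ^+ 2.
have f_sym k l : f k l = f l k by rewrite /f e_sym; case: ifP => // _; ring.
have f_diag k : f k k = 0 by rewrite /f e_irr subrr expr0n.
have nonedges : \sum_k \sum_l f k l <= S * Q.
  suff : \sum_(k < n) \sum_(l < n | (k < l)%N) f k l <= S * (Q / 2).
    by rewrite (sum_ord_sym f_sym f_diag); lra.
  rewrite /S mulr_suml; apply: ler_sum => k _; rewrite mulr_suml big_mkcondr /=.
  apply: ler_sum => l _; rewrite /f; case: (e k l) => //=.
  exact: sqr_sub_le_gdist.
have all_pairs : \sum_k \sum_l (y k - y l) ^+ 2 = Q + \sum_k \sum_l f k l.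
  rewrite -big_split /=; apply: eq_bigr => k _.
  rewrite (bigID (e k)) /=; congr (_ + _); rewrite big_mkcond /=.
  by apply: eq_bigr => l _; rewrite /f if_neg.
have total : 2 * n%:R * energy y <= (1 + S) * Q.
  have := sum_sqr_subE y0; rewrite card_ord all_pairs => <-.
  by rewrite mulrDl mul1r lerD2l.
have S0 : 0 < 1 + S by have := L_const_gt0; rewrite /L_const div1r invr_gt0.
by rewrite /L_const -/S div1r mulrAC mulrC ler_pdivrMl.
Qed.

End GraphDistance.

Section MinDegree.
Variables (n : nat) (e : rel 'I_n).

Lemma degreeE i : degree e i = #|e i|.
Proof.
rewrite /degree; apply: eq_card => k; rewrite unfold_in.
by apply/idP/idP => [/set_mem//|h]; apply/mem_set.
Qed.

Lemma min_degree_le i : (min_degree e <= degree e i)%N.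
Proof. exact: (bigmin_le _ i (degree e)). Qed.

Hypothesis e_conn : connected_graph e.

Lemma connected_neighbour i : (1 < n)%N -> exists j, e i j.
Proof.
rewrite -{1}[n]card_ord => /card_gt1P[k [l [_ _ kl]]].
have [j ji] : exists j : 'I_n, i != j.
  have [ik|] := eqVneq i k; last by exists k.
  by exists l; rewrite ik.
have /connectP[[|v p] /=] := e_conn i j.
  by move=> _ ij; rewrite ij eqxx in ji.
by case/andP => eiv _ _; exists v.
Qed.

Lemma min_degree_gt0 : (1 < n)%N -> (0 < min_degree e)%N.
Proof.
move=> n1; rewrite /min_degree; elim/big_ind: _ => [|k l|i _].
- exact: ltnW.
- by rewrite leq_min => -> ->.
- have [k eik] := connected_neighbour i n1.
  by rewrite degreeE; apply/card_gt0P; exists k.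
Qed.

Lemma min_degree_le_sum (R : realDomainType) (f : 'I_n -> R) i : (1 < n)%N ->
  (forall k, e i k -> 0 <= f k) ->
  exists2 k, e i k & (min_degree e)%:R * f k <= \sum_(k | e i k) f k.
Proof.
move=> n1 f0; have [k0 eik0] := connected_neighbour i n1.
case: (@arg_minP _ _ _ k0 (e i) f eik0) => k eik f_min; exists k => //.
apply: (@le_trans _ _ ((degree e i)%:R * f k)).
  by rewrite ler_wpM2r ?f0// ler_nat min_degree_le.
by rewrite degreeE mulr_natl -sumr_const; apply: ler_sum => l /f_min.
Qed.

End MinDegree.

(** * Differentiation on a half-line *)

Definition is_derive_oy (R : realType) (a : R) (f df : R -> R) : Prop :=
  f x @[x --> a^'+] --> f a /\
  forall t : R, a < t -> is_derive t 1 f (df t).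

Section IsDeriveOy.
Variables (R : realType) (a : R).
Implicit Types f g h df dg dh : R -> R.

Lemma is_derive_continuous f (t df : R) :
  is_derive t 1 f df -> {for t, continuous f}.
Proof.
by move=> [df_ex _]; exact/differentiable_continuous/derivable1_diffP.
Qed.

Lemma is_derive_mull (c t : R) : is_derive t 1 (fun s : R => c * s) c.
Proof.
exact: is_derive_eq (is_deriveZ c (is_derive_id t (1 : R))) (mulr1 c).
Qed.

Lemma is_derive_comp_oy h dh f df : (forall y : R, is_derive y 1 h (dh y)) ->
  is_derive_oy a f df ->
  is_derive_oy a (fun t => h (f t)) (fun t => dh (f t) * df t).
Proof.
move=> h_dh [f_a f_df]; split=> [|t at_].
  by apply: continuous_cvg => //; exact: is_derive_continuous (h_dh _).
exact: is_derive1_comp (h_dh _) (f_df t at_).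
Qed.

Lemma is_deriveB_oy f df g dg : is_derive_oy a f df -> is_derive_oy a g dg ->
  is_derive_oy a (fun t => f t - g t) (fun t => df t - dg t).
Proof.
move=> [f_a f_df] [g_a g_dg]; split=> [|t at_]; first exact: cvgB.
exact: is_deriveB (f_df t at_) (g_dg t at_).
Qed.

Lemma is_derive_sum_oy (I : Type) (r : seq I) (P : pred I)
    (f df : I -> R -> R) :
  (forall i, is_derive_oy a (f i) (df i)) ->
  is_derive_oy a (fun t => \sum_(i <- r | P i) f i t)
                 (fun t => \sum_(i <- r | P i) df i t).
Proof.
move=> f_df; split=> [|t at_].
  by apply: cvg_big => [|i _]; [exact: add_continuous | exact: (f_df i).1].
rewrite -fct_sumE; elim/big_ind2: _ => [|u du v dv|i _].
- exact: is_derive_cst.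
- exact: is_deriveD.
- exact: (f_df i).2.
Qed.

Lemma is_deriveMl_oy (c : R) f df :
  is_derive_oy a f df -> is_derive_oy a (fun t => c * f t) (fun t => c * df t).
Proof.
apply: (is_derive_comp_oy (h := fun y => c * y) (dh := fun=> c)) => y.
exact: is_derive_mull.
Qed.

Lemma is_deriveX_oy n f df : is_derive_oy a f df ->
  is_derive_oy a (fun t => f t ^+ n.+1) (fun t => n.+1%:R * f t ^+ n * df t).
Proof.
apply: (is_derive_comp_oy (h := fun y => y ^+ n.+1)
  (dh := fun y => n.+1%:R * y ^+ n)) => y.
have := is_deriveX n.+1 (is_derive_id y (1 : R)); rewrite exprfctE.
by move=> /is_derive_eq; apply; exact: mulr1.
Qed.

Lemma is_derive_eq_oy f df df' :
  is_derive_oy a f df -> df =1 df' -> is_derive_oy a f df'.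
Proof. by move=> f_df /funext <-. Qed.

Lemma is_derive_oy_within f df :
  is_derive_oy a f df -> {within `[a, +oo[, continuous f}.
Proof.
move=> [f_a f_df]; apply/continuous_within_itvcyP; split=> // t.
rewrite in_itv /= andbT => at_; exact: is_derive_continuous (f_df t at_).
Qed.

Lemma is_derive_oy_within_segment f df s t : a <= s ->
  is_derive_oy a f df -> {within `[s, t], continuous f}.
Proof.
move=> a_s /is_derive_oy_within; apply: continuous_subspaceW => r /=.
by rewrite !in_itv /= andbT => /andP[s_r _]; exact: le_trans s_r.
Qed.

Lemma MVT_oy f df s t : is_derive_oy a f df -> a <= s <= t ->
  exists2 u, s <= u <= t & f t - f s = df u * (t - s).
Proof.
move=> f_df /andP[a_s st].
have f_cont := is_derive_oy_within_segment (t := t) a_s f_df.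
have [r|u] := @MVT_segment _ f df s t st _ f_cont.
  by rewrite in_itv /= => /andP[sr _]; apply: f_df.2; exact: le_lt_trans sr.
by rewrite in_itv /=; exists u.
Qed.

End IsDeriveOy.

(** * Comparison principle *)

Lemma is_derive_ge0_left (R : realType) (f : R -> R) (s t df : R) : s < t ->
  is_derive t 1 f df -> (forall r, s < r < t -> f r <= f t) -> 0 <= df.
Proof.
move=> st [/cvg_dnbhs_at_left f_df <-] f_le; apply: cvgr_to_ge f_df _.
near=> h; have h0 : h < 0 by near: h; exact: nbhs_left_lt.
have sh : s - t < h by near: h; apply: nbhs_left_gt; rewrite subr_lt0.
rewrite /= [h *: 1]mulr1 /GRing.scale /= nmulr_rge0 ?invr_lt0// subr_le0.
by apply: f_le; lra.
Unshelve. all: by end_near. Qed.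

Lemma first_hitting_time (R : realType) (A : finType) (f : A -> R -> R)
    (s t : R) :
  (forall a, {within `[s, t], continuous (f a)}) ->
  s <= t -> (exists a, 0 <= f a t) ->
  exists T, [/\ s <= T <= t, exists a, 0 <= f a T &
                forall r a, s <= r < T -> f a r < 0].
Proof.
move=> f_cont st [a0 fa0].
pose B : set (subspace `[s, t]) :=
  \bigcup_a (f a @^-1` [set x | 0 <= x]).
have : closed B.
  apply: closed_bigcup => [|a _]; first exact: finite_finset.
  apply: preimage_closed; last exact: closed_ge.
  by move=> x _; exact: f_cont.
move=> /closed_subspaceP[V V_closed VB].
have B_compact : compact (`[s, t] `&` V).
  exact: compact_closedI (@segment_compact _ s t) V_closed.
have memB r : (`[s, t] `&` V) r <-> s <= r <= t /\ exists a, 0 <= f a r.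
  rewrite setIC VB /= in_itv /=; split=> [[[a _ far] r_st]|[r_st [a far]]].
    by split=> //; exists a.
  by split=> //; exists a.
have B_t : (`[s, t] `&` V) t.
  by apply/memB; rewrite st lexx; split=> //; exists a0.
have [T] := compact_EVT_min (ex_intro _ t B_t) B_compact
  (continuous_subspaceT (fun=> cvg_id)).
move=> /set_mem/memB[/andP[sT Tt] hitT] T_min.
exists T; split=> //; first by rewrite sT.
move=> r a /andP[sr rT]; rewrite ltNge; apply/negP => far.
have : T <= r.
  apply/T_min/mem_set/memB; rewrite sr (le_trans (ltW rT))//.
  by split=> //; exists a.
by rewrite leNgt rT.
Qed.

Lemma barrier (R : realType) (A : finType) (t0 : R) (f df : A -> R -> R) :
  (forall a, is_derive_oy t0 (f a) (df a)) ->
  (forall a, f a t0 < 0) ->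
  (forall a t, t0 < t -> (forall b, f b t <= 0) -> f a t = 0 -> df a t < 0) ->
  forall a t, t0 <= t -> f a t < 0.
Proof.
move=> f_df f_init f_bar a t t0t; rewrite ltNge; apply/negP => fat.
have f_cont b : {within `[t0, t], continuous (f b)}.
  exact: is_derive_oy_within_segment (lexx t0) (f_df b).
have [T [/andP[t0T _] [b fbT] before]] :=
  first_hitting_time f_cont t0t (ex_intro _ a fat).
have {}t0T : t0 < T.
  rewrite lt_neqAle t0T andbT; apply: contraTneq fbT => <-.
  by rewrite -ltNge.
have le0 c : f c T <= 0.
  have f_left := cvg_at_left_filter (is_derive_continuous ((f_df c).2 T t0T)).
  apply: cvgr_to_le f_left _; near=> r; apply/ltW/before/andP; split.
    by near: r; exact: nbhs_left_ge.
  by near: r; exact: nbhs_left_lt.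
have fbT0 : f b T = 0 by apply/eqP; rewrite eq_le le0.
have := f_bar b T t0T le0 fbT0; rewrite ltNge => /negP; apply.
apply: is_derive_ge0_left t0T ((f_df b).2 T t0T) _ => r /andP[t0r rT].
by rewrite fbT0 ltW// before// ltW.
Unshelve. all: by end_near. Qed.

(* At first contact of x with the boundary of r S, where S is the set to be
   proved invariant and r = 1 + eps exp(M t), the rescaled point x / r lies on
   the boundary of S, and M is large enough for r to outrun the outward
   velocity at x. The result follows by letting eps tend to 0. *)
Section HomogeneousInvariance.
Variables (R : realType) (V : lmodType R) (A : finType).
Variables (g dg : A -> V -> R) (d : A -> nat) (c rate : A -> R) (Y : set V).
Variable x : R -> V.
Hypothesis gZ : forall a r y, 0 < r -> g a (r *: y) = r ^+ (d a).+1 * g a y.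
Hypothesis YZ : forall r y, 0 < r -> Y y -> Y (r *: y).
Hypothesis c_gt0 : forall a, 0 < c a.
Hypothesis g_outward : forall a r y, 1 < r -> Y y ->
  (forall b, g b y <= c b) -> g a y = c a ->
  dg a (r *: y) <= r ^+ d a * (rate a * (r - 1)).
Hypothesis x_dg : forall a,
  is_derive_oy 0 (fun t => g a (x t)) (fun t => dg a (x t)).
Hypothesis Y_x : forall t, 0 <= t -> Y (x t).
Hypothesis g_init : forall a, g a (x 0) <= c a.

Let dilation (M eps t : R) : R := 1 + eps * expR (M * t).

Let is_derive_dilation M eps :
  is_derive_oy 0 (dilation M eps) (fun t => M * (dilation M eps t - 1)).
Proof.
have derive_t (t : R) :
    is_derive t 1 (dilation M eps) (M * (dilation M eps t - 1)).
  have := is_derive1_comp (is_derive_expR (M * t)) (is_derive_mull M t).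
  move=> /(is_deriveZ eps)/(is_deriveD (is_derive_cst (1 : R) t (1 : R))).
  by move=> /is_derive_eq; apply; rewrite /dilation /GRing.scale /=; ring.
split=> //; apply: cvg_at_right_filter.
exact: is_derive_continuous (derive_t 0).
Qed.

Let dilated_barrier M eps : 0 < eps ->
  (forall a, rate a < (d a).+1%:R * M * c a) ->
  forall a t, 0 <= t -> g a (x t) < dilation M eps t ^+ (d a).+1 * c a.
Proof.
move=> eps0 M_gt a t t0; rewrite -subr_lt0.
have r1 s : 1 < dilation M eps s by rewrite ltrDl mulr_gt0// expR_gt0.
pose gap a s := g a (x s) - dilation M eps s ^+ (d a).+1 * c a.
apply: (barrier (t0 := 0) (f := gap)) t0 => {a t} a.
- apply: is_deriveB_oy => //; under eq_fun do rewrite mulrC.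
  exact/is_deriveMl_oy/is_deriveX_oy/is_derive_dilation.
- rewrite subr_lt0; apply: le_lt_trans (g_init a) _.
  by rewrite ltr_pMl// exprn_egt1.
- move=> t t0; have := r1 t; set r := dilation M eps t => r_gt1.
  have r0 : 0 < r by lra.
  move=> g_le g_eq; pose y := r^-1 *: x t.
  have xE : x t = r *: y by rewrite scalerA divff ?scale1r// gt_eqF.
  have Yy : Y y by apply: YZ; rewrite ?invr_gt0//; apply: Y_x; exact: ltW.
  have gy b : g b y <= c b.
    have := g_le b; rewrite /gap xE gZ// -mulrBr.
    by rewrite pmulr_rle0 ?exprn_gt0// subr_le0.
  have gya : g a y = c a.
    move/eqP: g_eq; rewrite /gap xE gZ// -mulrBr mulf_eq0 expf_eq0 gt_eqF//=.
    by rewrite subr_eq0 => /eqP.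
  rewrite subr_lt0 xE; apply: le_lt_trans (g_outward r_gt1 Yy gy gya) _.
  have -> : c a * ((d a).+1%:R * r ^+ d a * (M * (r - 1))) =
      r ^+ d a * ((d a).+1%:R * M * c a * (r - 1)) by ring.
  by rewrite ltr_pM2l ?exprn_gt0// ltr_pM2r ?subr_gt0.
Qed.

Lemma homogeneous_invariance a t : 0 <= t -> g a (x t) <= c a.
Proof.
move=> t0.
have : \forall M \near +oo, forall b, rate b / ((d b).+1%:R * c b) < M.
  by apply: filter_forall => b; apply: nbhs_pinfty_gt; exact: num_real.
move=> /filter_ex[M M_gt].
have dilation_cvg : dilation M eps t @[eps --> 0^'+] --> (1 : R).
  rewrite -[X in _ --> X](_ : 1 + 0 * expR (M * t) = 1); last by ring.
  apply: cvgD; first exact: cvg_cst.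
  by apply: cvgM; [exact: cvg_within | exact: cvg_cst].
have : dilation M eps t ^+ (d a).+1 * c a @[eps --> 0^'+] --> c a.
  rewrite -[X in _ --> X](_ : 1 ^+ (d a).+1 * c a = c a); last first.
    by rewrite expr1n mul1r.
  apply: cvgM; last exact: cvg_cst.
  exact: cvg_comp dilation_cvg (@exprn_continuous _ _ (1 : R)).
move=> /cvgr_to_ge; apply; near=> eps; apply/ltW/dilated_barrier => // b.
by rewrite mulrAC -ltr_pdivrMl ?mulr_gt0// mulrC.
Unshelve. all: by end_near. Qed.

End HomogeneousInvariance.

(** * Convergence criteria *)

(* Over a window of fixed length, P grows by at least a multiple of the value of
   G at its left end; but P is bounded. *)
Lemma barbalat (R : realType) (P G : R -> R) (m c : R) :
  is_derive_oy 0 P G -> (forall t, 0 <= t -> P t <= m) ->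
  (forall t, 0 <= G t) -> 0 <= c ->
  (forall s t, 0 <= s <= t -> G s - G t <= c * (t - s)) ->
  G t @[t --> +oo] --> 0.
Proof.
move=> P_G P_le G0 c0 G_lip; apply/cvgrPdist_lt => eps eps0.
have P_nondecr s t : 0 <= s <= t -> P s <= P t.
  move=> st; have [u _ Pst] := MVT_oy P_G st.
  by rewrite -subr_ge0 Pst mulr_ge0// subr_ge0; case/andP: st.
pose range_P := [set P t | t in [set t | 0 <= t]].
have supP : has_sup range_P.
  split; first by exists (P 0), 0 => /=.
  by exists m => _ [t /= t0 <-]; exact: P_le.
pose h := eps / (2 * (c + 1)).
have h0 : 0 < h by rewrite divr_gt0//; lra.
have ch : c * h <= eps / 2.
  have : h * (2 * (c + 1)) = eps by rewrite divfK// gt_eqF//; lra.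
  lra.
have gain0 : 0 < h * (eps / 2) by rewrite mulr_gt0//; lra.
have [_ [T /= T0 <-] PT] := sup_adherent gain0 supP.
near=> t; rewrite sub0r normrN ger0_norm//.
have Tt : T <= t by near: t; apply: nbhs_pinfty_ge; exact: num_real.
have [|u tu Pu] := @MVT_oy _ _ _ _ t (t + h) P_G; first lra.
have Pt : P T <= P t by apply: P_nondecr; lra.
have Pth : P (t + h) <= sup range_P.
  by apply: ub_le_sup; [case: supP | exists (t + h) => //=; lra].
have Gu : G u < eps / 2 by rewrite -(ltr_pM2r h0); lra.
have Gtu : G t - G u <= c * (u - t) by apply: G_lip; lra.
have : c * (u - t) <= c * h by rewrite ler_wpM2l//; lra.
lra.
Unshelve. all: by end_near. Qed.

Lemma ler_coord_norm (R : realType) (n : nat) (v : 'rV[R]_n) i :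
  `|v ord0 i| <= `|v|.
Proof.
rewrite {2}/Num.norm /= mx_normrE.
exact: (le_bigmax 0 (fun k : 'I_1 * 'I_n => `|v k.1 k.2|) (ord0, i)).
Qed.

Lemma compact_near_zeros (R : realType) (V : normedModType R) (B : set V)
    (G : V -> R) (eps : R) :
  compact B -> continuous G -> (forall v, 0 <= G v) -> 0 < eps ->
  exists2 eta, 0 < eta &
    forall v, B v -> G v < eta -> exists2 z, G z = 0 & `|v - z| < eps.
Proof.
move=> B_compact G_cont G0 eps0.
pose U := \bigcup_(z in [set z | G z = 0]) ball z eps.
have U_open : open U by apply: bigcup_open => z _; exact: ball_open.
have far_compact : compact (B `&` ~` U).
  exact: compact_closedI B_compact (open_closedC U_open).
have near_zero v : B v -> ~ (B `&` ~` U) v ->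
    exists2 z, G z = 0 & `|v - z| < eps.
  move=> Bv /not_andP[//|/contrapT[z /= Gz]].
  by rewrite -ball_normE /ball_ /= distrC; exists z.
have [far0|no_far] := pselect (B `&` ~` U !=set0); last first.
  exists 1 => // v Bv _; apply: near_zero => // far_v.
  by apply: no_far; exists v.
have [v /set_mem [_ Uv] v_min] :=
  compact_EVT_min far0 far_compact (continuous_subspaceT G_cont).
exists (G v) => [|w Bw Gw].
  rewrite lt_neqAle G0 andbT eq_sym; apply/eqP => Gv; apply: Uv.
  by exists v => //; exact: ballxx.
apply: near_zero => // far_w; move: Gw; rewrite ltNge => /negP; apply.
by apply: v_min; exact/mem_set.
Qed.

(** * The velocity field *)

Section VelocityField.
Variables (R : realType) (n : nat) (e : rel 'I_n) (K : R) (w : 'I_n -> R).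
Hypotheses (e_simple : simple_graph e) (K_ge0 : 0 <= K).
Implicit Types (x y : 'I_n -> R) (b r D : R) (i j k : 'I_n).
Local Notation rhs := (kuramoto_rhs e K w).

Lemma norm_coupling_le i (s : 'I_n -> R) b : (forall k, `|s k| <= b) ->
  `|K / n%:R * \sum_(k | e i k) s k| <= K * b.
Proof.
move=> s_le.
have n0 : 0 < n%:R :> R by rewrite ltr0n (leq_ltn_trans _ (ltn_ord i)).
have b0 : 0 <= b by apply: le_trans (s_le i).
rewrite normrM ger0_norm ?divr_ge0// -mulrA ler_wpM2l// ler_pdivrMl//.
apply: le_trans (ler_norm_sum _ _ _) _.
rewrite big_mkcond -[n in leRHS]card_ord.
by apply: ler_sum_card => k; case: ifP.
Qed.

Lemma rhs_lipschitz x y b i :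
  (forall k, `|(x k - x i) - (y k - y i)| <= b) ->
  `|rhs x i - rhs y i| <= K * b.
Proof.
move=> xy_le; rewrite /kuramoto_rhs opprD addrACA subrr add0r -mulrBr -sumrB.
by apply: norm_coupling_le => k; exact: le_trans (ler_dist_sin _ _) (xy_le k).
Qed.

Definition speed_bound : R := \sum_j `|w j| + K.

Lemma speed_bound_ge0 : 0 <= speed_bound.
Proof. by rewrite addr_ge0// sumr_ge0. Qed.

Lemma norm_rhs_le x i : `|rhs x i| <= speed_bound.
Proof.
apply: le_trans (ler_normD _ _) _; apply: lerD.
  by rewrite (bigD1 i) //= lerDl sumr_ge0.
rewrite -[leRHS]mulr1; apply: norm_coupling_le => k.
exact: sin_max.
Qed.

Lemma energy_rhs_lipschitz x y b : (forall i, `|x i - y i| <= b) ->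
  energy (rhs x) - energy (rhs y) <= n%:R * (K * (2 * b) * (2 * speed_bound)).
Proof.
move=> xy_le; rewrite -sumrB -[n in leRHS]card_ord.
apply: ler_sum_card => i; rewrite subr_sqr; apply: le_trans (ler_norm _) _.
rewrite normrM ler_pM//.
  apply: rhs_lipschitz => k.
  have -> : x k - x i - (y k - y i) = (x k - y k) - (x i - y i) by ring.
  apply: le_trans (ler_normB _ _) _.
  by have := xy_le k; have := xy_le i; lra.
apply: le_trans (ler_normD _ _) _.
by have := norm_rhs_le x i; have := norm_rhs_le y i; lra.
Qed.

Lemma continuous_rhs i : continuous (fun v : 'rV[R]_n => rhs (v ord0) i).
Proof.
move=> v; have coord k : (u : 'rV[R]_n) ord0 k @[u --> v] --> v ord0 k.
  exact: coord_continuous.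
apply: (@cvgD _ _ _ (nbhs v)); first exact: (@cvg_cst _ (w i) _ (nbhs v)).
apply: (@cvgM _ _ (nbhs v)); first exact: (@cvg_cst _ (K / n%:R) _ (nbhs v)).
apply: (@cvg_big _ _ _ _ _ _ _ (nbhs v)) => [|k _]; first exact: add_continuous.
apply: continuous_cvg; first exact: continuous_sin.
exact: (@cvgB _ _ _ (nbhs v)).
Qed.

Lemma continuous_energy_rhs :
  continuous (fun v : 'rV[R]_n => energy (rhs (v ord0))).
Proof.
move=> v; apply: (@cvg_big _ _ _ _ _ _ _ (nbhs v)) => [|i _].
  exact: add_continuous.
by apply: (@cvgM _ _ (nbhs v)); exact: continuous_rhs.
Qed.

Lemma sum_mul_rhs x y : \sum_i x i * rhs y i =
  \sum_i x i * w i -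
  K / n%:R / 2 * edge_sum e (fun u v => (x u - x v) * sin (y u - y v)).
Proof.
have sinC u v : sin (y u - y v) = - sin (y v - y u) by rewrite -sinN opprB.
have -> : edge_sum e (fun u v => (x u - x v) * sin (y u - y v)) =
    - (2 * \sum_u x u * \sum_(v | e u v) sin (y v - y u)).
  rewrite (edge_sum_by_parts _ e_simple.1) // -sumrN; apply: eq_bigr => u _.
  by rewrite -sumrN; apply: eq_bigr => v _; rewrite sinC mulrN.
have -> : \sum_i x i * rhs y i = \sum_i x i * w i +
    K / n%:R * \sum_u x u * \sum_(v | e u v) sin (y v - y u).
  rewrite mulr_sumr -big_split; apply: eq_bigr => i _ /=.
  by rewrite /kuramoto_rhs; ring.
lra.
Qed.

Lemma sum_rhs y : \sum_i w i = 0 -> \sum_i rhs y i = 0.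
Proof.
move=> w0; under eq_bigr do rewrite -[rhs y _]mul1r.
rewrite (sum_mul_rhs (fun=> 1)) /edge_sum.
under eq_bigr do rewrite mul1r.
rewrite w0 big1 ?mulr0 ?subr0// => u _.
by rewrite big1// => v _; rewrite subrr mul0r.
Qed.

Lemma norm_rhsZ_sub_le y r D i : 1 <= r -> spread y <= D ->
  `|rhs (fun k => r * y k) i - rhs y i| <= K * ((r - 1) * D).
Proof.
move=> r1 y_D; apply: rhs_lipschitz => k.
have -> : r * y k - r * y i - (y k - y i) = (r - 1) * (y k - y i) by ring.
rewrite normrM ger0_norm ?subr_ge0// ler_wpM2l ?subr_ge0//.
exact: le_trans (ler_dist_spread _ _ _) y_D.
Qed.

Lemma sum_mul_rhsZ_le y r D E0 : 1 <= r -> spread y <= D ->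
  energy y <= E0 -> \sum_i y i * rhs y i <= 0 ->
  \sum_i y i * rhs (fun k => r * y k) i <=
  n%:R * (Num.sqrt E0 * (K * ((r - 1) * D))).
Proof.
move=> r1 y_D y_E energy_in.
have -> : \sum_i y i * rhs (fun k => r * y k) i = \sum_i y i * rhs y i +
    \sum_i y i * (rhs (fun k => r * y k) i - rhs y i).
  by rewrite -big_split /=; apply: eq_bigr => i _; ring.
rewrite -[leRHS]add0r lerD// -[n in leRHS]card_ord.
apply: ler_sum_card => i; apply: le_trans (ler_norm _) _.
rewrite normrM ler_pM//; first exact: norm_le_sqrt_energy.
exact: norm_rhsZ_sub_le.
Qed.

Lemma sum_mul_rhs_le y D : (0 < n)%N -> connected_graph e -> 0 < D ->
  D <= pi -> \sum_i y i = 0 -> spread y <= D ->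
  \sum_i y i * rhs y i <=
  Num.sqrt (energy y) * Num.sqrt (energy w) -
  K * L_const R e * (sin D / D) * energy y.
Proof.
move=> n_gt0 e_conn D0 D_pi y0 y_D.
rewrite sum_mul_rhs lerB ?cauchy_schwarz_sum//.
set T := edge_sum _ _.
have sinD0 : 0 <= sin D by apply: sin_ge0_pi; lra.
have T_ge : edge_sum e (fun u v => (y u - y v) ^+ 2) * sin D <= D * T.
  rewrite mulr_suml mulr_sumr; apply: ler_sum => u _.
  rewrite mulr_suml mulr_sumr; apply: ler_sum => v _.
  by apply: sqr_sin_chord => //; exact: le_trans (ler_dist_spread _ _ _) y_D.
have := ler_wpM2r sinD0 (energy_le_edge_sum e_conn e_simple y0).
move=> /le_trans/(_ T_ge) T_energy.
have nD0 : 0 < n%:R * D by rewrite mulr_gt0 ?ltr0n.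
have -> : K * L_const R e * (sin D / D) * energy y =
    K * (2 * n%:R * L_const R e * energy y * sin D) / 2 / (n%:R * D).
  by field; rewrite !gt_eqF ?ltr0n.
have -> : K / n%:R / 2 * T = K * (D * T) / 2 / (n%:R * D).
  by field; rewrite !gt_eqF ?ltr0n.
rewrite ler_pM2r ?invr_gt0// ler_pM2r ?invr_gt0 ?ltr0n//.
exact: ler_wpM2l.
Qed.

Lemma sum_mul_rhs_le0 y D : connected_graph e -> 0 < D -> D < pi ->
  \sum_i y i = 0 -> spread y <= D -> 0 < energy y ->
  Num.sqrt (energy w) * D / (Num.sqrt (energy y) * L_const R e * sin D) <= K ->
  \sum_i y i * rhs y i <= 0.
Proof.
move=> e_conn D0 D_pi y0 y_D Ey0.
have n_gt0 : (0 < n)%N.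
  have [i _|/eqP|i _] := @psumr_neq0P _ _ xpredT (fun i => y i ^+ 2).
  - exact: sqr_ge0.
  - by rewrite gt_eqF.
  - exact: leq_ltn_trans (ltn_ord i).
have sinD0 : 0 < sin D by apply: sin_gt0_pi; lra.
have sqrtE0 : 0 < Num.sqrt (energy y) by rewrite sqrtr_gt0.
rewrite (ler_pdivrMr _ _ (mulr_gt0 (mulr_gt0 sqrtE0 (L_const_gt0 e R)) sinD0)).
move=> K_ge.
apply: le_trans (sum_mul_rhs_le n_gt0 e_conn D0 (ltW D_pi) y0 y_D) _.
rewrite subr_le0 -[in leRHS](sqr_sqrtr (ltW Ey0)).
have -> : K * L_const R e * (sin D / D) * Num.sqrt (energy y) ^+ 2 =
  Num.sqrt (energy y) * (K * (Num.sqrt (energy y) * L_const R e * sin D) / D).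
  by field; rewrite gt_eqF.
by rewrite ler_pM2l// ler_pdivlMr.
Qed.

End VelocityField.

(** * Pairs of phases at maximal distance *)

Section ExtremalPair.
Variables (R : realType) (n : nat) (y : 'I_n -> R) (D s : R) (i j : 'I_n).
Hypotheses (D_gt0 : 0 < D) (yijD : y i - y j = D).

Lemma extremal_neq : i != j.
Proof. by apply: contraTneq D_gt0 => ij; rewrite -yijD ij subrr ltxx. Qed.

Lemma extremal_sum_sqr_le_energy (k : seq 'I_n) : uniq [:: i, j & k] ->
  y i ^+ 2 + y j ^+ 2 + \sum_(l <- k) y l ^+ 2 <= energy y.
Proof.
move=> /(ler_sum_uniq (f := fun l => y l ^+ 2))/(_ (fun=> sqr_ge0 _)).
by rewrite !big_cons addrA.
Qed.

Lemma sqr_extremal_le_energy : D ^+ 2 / 2 <= energy y.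
Proof.
have := @extremal_sum_sqr_le_energy [::].
rewrite big_nil /= inE extremal_neq => /(_ isT).
by rewrite -yijD; have := sqr_ge0 (y i + y j); lra.
Qed.

Hypothesis D_le_pihalf : D <= pi / 2.
Hypothesis s_itv : 0 <= s <= D / 2.
Hypothesis energy_le : energy y <= s ^+ 2 + D ^+ 2 / 2.
Hypothesis y_spread : spread y <= D.

Let y_D k l : y k - y l <= D.
Proof. exact: le_trans (ler_spread _ _ _) y_spread. Qed.

Let m := (y i + y j) / 2.
Let yiE : y i = m + D / 2. Proof. by rewrite /m -yijD; field. Qed.
Let yjE : y j = m - D / 2. Proof. by rewrite /m -yijD; field. Qed.

Lemma sqr_deviation_le k : k != i -> k != j ->
  2 / 3 * (y k - m) ^+ 2 <= s ^+ 2.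
Proof.
move=> ki kj; have := @extremal_sum_sqr_le_energy [:: k].
rewrite /= !inE !negb_or extremal_neq ![_ == k]eq_sym ki kj big_seq1.
move=> /(_ isT); rewrite yiE yjE.
by have := energy_le; have := sqr_ge0 (m + (y k - m) / 3); lra.
Qed.

Lemma sqr_deviation2_le k l : uniq [:: i; j; k; l] ->
  2 * ((y k - y l) / 2) ^+ 2 + ((y k + y l) / 2 - m) ^+ 2 <= s ^+ 2.
Proof.
move=> /(@extremal_sum_sqr_le_energy [:: k; l]).
rewrite !big_cons big_nil yiE yjE.
by have := energy_le; have := sqr_ge0 (2 * m + ((y k + y l) / 2 - m)); lra.
Qed.

Lemma sin_deviation_ge k : k != i -> k != j ->
  2 * sin (D / 2 - s) <= sin (y i - y k) + sin (y k - y j).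
Proof.
move=> ki kj.
have -> : y i - y k = D / 2 - (y k - m) by rewrite yiE; ring.
have -> : y k - y j = D / 2 + (y k - m) by rewrite yjE; ring.
rewrite sinB_add_sinD ler_pM2l// sinB_le_sinM_cos//.
  by have := D_le_pihalf; lra.
exact: sqr_deviation_le.
Qed.

Lemma sin_deviation2_ge k l : uniq [:: i; j; k; l] ->
  2 * sin (D / 2 - s) <= sin (y i - y k) + sin (y l - y j).
Proof.
move=> ijkl; rewrite sin_add_sin ler_pM2l//.
have -> : (y i - y k + (y l - y j)) / 2 = D / 2 - (y k - y l) / 2.
  by rewrite yiE yjE; field.
have -> : (y i - y k - (y l - y j)) / 2 = - ((y k + y l) / 2 - m).
  by rewrite yiE yjE; field.
rewrite cosN sinB_le_sinBM_cos//; first by have := D_le_pihalf; lra.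
exact: sqr_deviation2_le.
Qed.

Lemma extremal_gap_itv k : (0 <= y i - y k <= D) && (0 <= y k - y j <= D).
Proof. by have := y_D k j; have := y_D i k; rewrite -yijD; lra. Qed.

(* If k = j or l = i, monotonicity of sin on [-pi/2, pi/2] reduces the bound to
   the case of a common neighbour k = l. *)
Lemma extremal_coupling_ge k l : k != i -> l != j ->
  2 * sin (D / 2 - s) <= sin (y i - y k) + sin (y l - y j).
Proof.
move=> ki lj; have pi0 := pi_gt0 R.
have sin_le_sinD x : - (D / 2) <= x <= D -> sin x <= sin D.
  by move=> x_D; rewrite ler_sin ?in_itv /=; have := D_le_pihalf; lra.
have [->|kj] := eqVneq k j; have [->|li] := eqVneq l i.
- by rewrite yijD mulr_natl mulr2n lerD// sin_le_sinD//; have := s_itv; lra.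
- apply: le_trans (sin_deviation_ge li lj) _; rewrite lerD2r yijD.
  by apply: sin_le_sinD; have := extremal_gap_itv l; have := D_gt0; lra.
- apply: le_trans (sin_deviation_ge ki kj) _; rewrite lerD2l yijD.
  by apply: sin_le_sinD; have := extremal_gap_itv k; have := D_gt0; lra.
- have [<-|kl] := eqVneq k l; first exact: sin_deviation_ge.
  apply: sin_deviation2_ge.
  rewrite /= !inE !negb_or extremal_neq kl ![i == _]eq_sym ![j == _]eq_sym.
  by rewrite ki kj li lj.
Qed.

Variables (e : rel 'I_n) (K : R) (w : 'I_n -> R).
Hypotheses (e_irr : irreflexive e) (e_conn : connected_graph e).
Hypotheses (K_ge0 : 0 <= K) (s_lt : s < D / 2).

Lemma rhs_extremal_le :
  n%:R * `|w i - w j| / (2 * (min_degree e)%:R * sin (D / 2 - s)) <= K ->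
  kuramoto_rhs e K w y i <= kuramoto_rhs e K w y j.
Proof.
have n1 : (1 < n)%N.
  rewrite -[n]card_ord; apply/card_gt1P; exists i, j; split=> //.
  exact: extremal_neq.
have n0 : 0 < n%:R :> R by rewrite ltr0n ltnW.
have pi0 := pi_gt0 R; have sin_gt0 : 0 < sin (D / 2 - s).
  by apply: sin_gt0_pi; have := s_itv; have := D_le_pihalf; have := s_lt; lra.
rewrite ler_pdivrMr ?mulr_gt0 ?ltr0n ?min_degree_gt0//.
set delta : R := (min_degree e)%:R => w_le.
have sin_ge0 z : 0 <= z <= D -> 0 <= sin z.
  by move=> zD; apply: sin_ge0_pi; have := D_le_pihalf; lra.
have [k _|k eik F_ge] :=
  @min_degree_le_sum _ _ e_conn R (fun k => sin (y i - y k)) i n1.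
  by apply: sin_ge0; case/andP: (extremal_gap_itv k).
have [l _|l ejl G_ge] :=
  @min_degree_le_sum _ _ e_conn R (fun k => sin (y k - y j)) j n1.
  by apply: sin_ge0; case/andP: (extremal_gap_itv l).
have e_neq u v : e u v -> v != u by apply: contraTneq => ->; rewrite e_irr.
have coupling := extremal_coupling_ge (e_neq _ _ eik) (e_neq _ _ ejl).
rewrite /kuramoto_rhs; under eq_bigr do rewrite -opprB sinN.
rewrite sumrN; set F := \sum_(k | e i k) _ in F_ge *.
set G := \sum_(k | e j k) _ in G_ge *.
have FG_ge : delta * (2 * sin (D / 2 - s)) <= F + G.
  by have := ler_wpM2l (ler0n R (min_degree e)) coupling; rewrite -/delta; lra.
have : n%:R * (w i - w j) <= K * (F + G).
  apply: (@le_trans _ _ (n%:R * `|w i - w j|)).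
    by rewrite ler_pM2l ?ler_norm.
  by apply: le_trans w_le _; have := ler_wpM2l K_ge0 FG_ge; lra.
rewrite mulrC -ler_pdivlMr//.
have -> : K * (F + G) / n%:R = K / n%:R * F + K / n%:R * G by ring.
lra.
Qed.

End ExtremalPair.

Lemma rhs_extremal_le_threshold (R : realType) (n : nat) (e : rel 'I_n) (K : R)
    (w y : 'I_n -> R) (D E0 : R) (i j : 'I_n) :
  irreflexive e -> connected_graph e -> 0 <= K -> 0 < D -> D <= pi / 2 ->
  (E0 < 3 / 4 * D ^+ 2 /\
    n%:R * `|w i - w j| /
      (2 * (min_degree e)%:R * sin (D / 2 - Num.sqrt (E0 - D ^+ 2 / 2))) <= K)
  \/ E0 < D ^+ 2 / 2 ->
  spread y <= D -> energy y <= E0 -> y i - y j = D ->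
  kuramoto_rhs e K w y i <= kuramoto_rhs e K w y j.
Proof.
move=> e_irr e_conn K0 D0 D_pi thr y_D y_E yijD.
have D_E := le_trans (sqr_extremal_le_energy D0 yijD) y_E.
case: thr => [[E0_lt K_ge]|]; last by rewrite ltNge D_E.
set s := Num.sqrt _ in K_ge.
have s_sqr : s ^+ 2 = E0 - D ^+ 2 / 2 by rewrite sqr_sqrtr ?subr_ge0.
have s_lt : s < D / 2.
  rewrite -ltr_sqr ?nnegrE ?sqrtr_ge0 ?divr_ge0 ?(ltW D0)// s_sqr; lra.
apply: (rhs_extremal_le D0 yijD D_pi _ _ y_D e_irr e_conn K0 s_lt) => //.
  by rewrite sqrtr_ge0 ltW.
by rewrite s_sqr; lra.
Qed.

(** * Solutions *)

Definition potential (R : realType) (n : nat) (e : rel 'I_n) (K : R)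
    (w x : 'I_n -> R) : R :=
  \sum_i w i * x i -
  K / n%:R / 2 * edge_sum e (fun u v => 1 - cos (x u - x v)).

Section Solutions.
Variables (R : realType) (n : nat) (e : rel 'I_n) (K : R) (w : 'I_n -> R).
Variable phi : R -> 'I_n -> R.
Hypotheses (e_simple : simple_graph e) (K_gt0 : 0 < K).
Hypothesis phi_sol : is_solution e K w phi.
Implicit Types (x y : 'I_n -> R) (b r s t D : R) (i j k : 'I_n).
Local Notation rhs := (kuramoto_rhs e K w).

Lemma is_derive_phase i :
  is_derive_oy 0 (fun t => phi t i) (fun t => rhs (phi t) i).
Proof. by split=> [|t t0]; [exact: phi_sol.1 | exact: phi_sol.2]. Qed.

Lemma sum_phase_constant t : \sum_i w i = 0 -> 0 <= t ->
  \sum_i phi t i = \sum_i phi 0 i.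
Proof.
move=> w0 t0.
have sum_der := is_derive_sum_oy (index_enum 'I_n) xpredT is_derive_phase.
have [|u _ /eqP] := @MVT_oy _ _ _ _ 0 t sum_der; first by rewrite lexx.
by rewrite sum_rhs// mul0r subr_eq0 => /eqP.
Qed.

Lemma is_derive_energy : is_derive_oy 0 (fun t => energy (phi t))
  (fun t => 2 * \sum_i phi t i * rhs (phi t) i).
Proof.
apply: is_derive_eq_oy.
  by apply: is_derive_sum_oy => i; exact/is_deriveX_oy/is_derive_phase.
by move=> t /=; rewrite mulr_sumr; apply: eq_bigr => i _; rewrite expr1 mulrA.
Qed.

Lemma is_derive_potential : is_derive_oy 0 (fun t => potential e K w (phi t))
  (fun t => energy (rhs (phi t))).
Proof.
have derive_1Bcos (y : R) : is_derive y 1 (fun z => 1 - cos z) (sin y).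
  have := is_deriveB (is_derive_cst (1 : R) y (1 : R)) (is_derive_cos y).
  by move=> /is_derive_eq; apply; rewrite sub0r opprK.
apply: is_derive_eq_oy.
  apply: is_deriveB_oy.
    by apply: is_derive_sum_oy => i; exact/is_deriveMl_oy/is_derive_phase.
  apply: is_deriveMl_oy; apply: is_derive_sum_oy => u.
  apply: is_derive_sum_oy => v; apply: is_derive_comp_oy derive_1Bcos _.
  exact: is_deriveB_oy (is_derive_phase u) (is_derive_phase v).
move=> t /=.
have -> : energy (rhs (phi t)) = \sum_i rhs (phi t) i * rhs (phi t) i.
  by apply: eq_bigr => i _; rewrite expr2.
rewrite sum_mul_rhs//; congr (_ - _ * _).
  by apply: eq_bigr => i _; rewrite mulrC.
by apply: eq_bigr => u _; apply: eq_bigr => v _; rewrite mulrC.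
Qed.

Lemma potential_le x b : (forall i, `|x i| <= b) ->
  potential e K w x <= \sum_i `|w i| * b.
Proof.
move=> x_le; rewrite /potential -[leRHS]subr0 lerB//.
  apply: ler_sum => i _; apply: le_trans (ler_norm _) _.
  by rewrite normrM ler_wpM2l.
rewrite mulr_ge0 ?divr_ge0 ?(ltW K_gt0)//.
by do 2!apply: sumr_ge0 => ? _; rewrite subr_ge0 cos_le1.
Qed.

Lemma phase_lipschitz s t i : 0 <= s <= t ->
  `|phi s i - phi t i| <= speed_bound K w * (t - s).
Proof.
move=> st; have [u _ phi_st] := MVT_oy (is_derive_phase i) st.
case/andP: st => _ st.
rewrite distrC phi_st normrM [`|t - s|]ger0_norm ?subr_ge0//.
by rewrite ler_wpM2r ?subr_ge0// norm_rhs_le// ltW.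
Qed.

Lemma energy_rhs_cvg0 b : (forall t, 0 <= t -> forall i, `|phi t i| <= b) ->
  energy (rhs (phi t)) @[t --> +oo] --> 0.
Proof.
move=> phi_le; have speed0 := speed_bound_ge0 w (ltW K_gt0).
pose c := n%:R * (K * (2 * speed_bound K w) * (2 * speed_bound K w)).
apply: (barbalat (c := c) is_derive_potential).
- by move=> t t0; exact: potential_le (phi_le t t0).
- by move=> t; exact: energy_ge0.
- by rewrite !mulr_ge0// ltW.
- move=> s t st; have -> : c * (t - s) =
      n%:R * (K * (2 * (speed_bound K w * (t - s))) * (2 * speed_bound K w)).
    by rewrite /c; ring.
  by apply: energy_rhs_lipschitz => [|i]; [exact: ltW | exact: phase_lipschitz].
Qed.

Lemma bounded_solution_approaches b :
  (forall t, 0 <= t -> forall i, `|phi t i| <= b) ->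
  approaches phi (equilibria e K w).
Proof.
move=> phi_le eps eps0.
pose box := [set v : 'rV[R]_n | forall i, `[- b, b]%classic (v ord0 i)].
have box_compact : compact box.
  apply: (@rV_compact _ _ (fun=> `[- b, b]%classic)) => i.
  exact: segment_compact.
have [eta eta0 near_zero] := compact_near_zeros box_compact
  (@continuous_energy_rhs _ _ e K w) (fun=> energy_ge0 _) eps0.
have [T [_ speed_lt]] := cvgr_lt _ (energy_rhs_cvg0 phi_le) _ eta0.
exists (Num.max 0 T + 1) => t Tt.
have max_ge : (0 <= Num.max 0 T) && (T <= Num.max 0 T).
  by rewrite !le_max !lexx orbT.
have /andP[t0 T_t] : (0 <= t) && (T < t) by lra.
pose v : 'rV[R]_n := \row_i phi t i.
have vE : v ord0 = phi t by apply/funext => i; rewrite mxE.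
have [||z Gz zv] := near_zero v.
- by move=> i /=; rewrite vE in_itv /= -ler_norml; exact: phi_le.
- by rewrite vE; exact: speed_lt.
exists (z ord0) => i; first by apply: energy_le0; rewrite Gz.
apply: le_lt_trans zv.
by have := ler_coord_norm (v - z) i; rewrite !mxE.
Qed.

Lemma kuramoto_invariance D E0 :
  \sum_i w i = 0 -> 0 < D -> 0 < E0 ->
  (forall y, \sum_i y i = 0 -> spread y <= D -> energy y <= E0 ->
     forall i j, y i - y j = D -> rhs y i <= rhs y j) ->
  (forall y, \sum_i y i = 0 -> spread y <= D -> energy y = E0 ->
     \sum_i y i * rhs y i <= 0) ->
  \sum_i phi 0 i = 0 -> spread (phi 0) <= D -> energy (phi 0) <= E0 ->
  forall t, 0 <= t -> spread (phi t) <= D /\ energy (phi t) <= E0.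
Proof.
move=> w0 D0 E00 extremal_in energy_in sum0 phi0_D phi0_E t t0.
pose g (a : option ('I_n * 'I_n)) (y : 'I_n -> R) :=
  if a is Some (i, j) then y i - y j else energy y.
pose dg (a : option ('I_n * 'I_n)) (y : 'I_n -> R) :=
  if a is Some (i, j) then rhs y i - rhs y j else 2 * \sum_i y i * rhs y i.
pose d (a : option ('I_n * 'I_n)) := if a is Some _ then 0%N else 1%N.
pose c (a : option ('I_n * 'I_n)) := if a is Some _ then D else E0.
pose rate (a : option ('I_n * 'I_n)) :=
  if a is Some _ then 2 * (K * D) else 2 * (n%:R * (Num.sqrt E0 * (K * D))).
suff g_le a : g a (phi t) <= c a.
  split; last exact: g_le None.
  by apply: spread_le => [|i j]; [exact: ltW | exact: g_le (Some (i, j))].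
apply: (homogeneous_invariance (dg := dg) (d := d) (rate := rate)
  (Y := [set y | \sum_i y i = 0])) t0 => {t a}.
- move=> [[i j]|] r y _; last exact: energyZ.
  by rewrite expr1 mulrBr.
- by move=> r y _ /= y0; rewrite -mulr_sumr y0 mulr0.
- by case.
- move=> a r y r1 /= y0 gy.
  have y_D : spread y <= D.
    by apply: spread_le => [|i j]; [exact: ltW | exact: gy (Some (i, j))].
  have y_E : energy y <= E0 := gy None.
  have rhs_r i : `|rhs (r *: y) i - rhs y i| <= K * ((r - 1) * D).
    by apply: norm_rhsZ_sub_le y_D; exact: ltW.
  case: a => [[i j]|] /= gya.
    have := extremal_in y y0 y_D y_E i j gya.
    have := rhs_r i; have := rhs_r j; rewrite !ler_norml expr0 mul1r; lra.
  have rate_le : \sum_i y i * rhs (r *: y) i <=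
      n%:R * (Num.sqrt E0 * (K * ((r - 1) * D))).
    by apply: sum_mul_rhsZ_le y_D y_E (energy_in y y0 y_D gya); exact: ltW.
  have -> : \sum_i (r *: y) i * rhs (r *: y) i =
      r * \sum_i y i * rhs (r *: y) i.
    by rewrite mulr_sumr; apply: eq_bigr => i _; rewrite mulrA.
  by rewrite expr1 mulrCA ler_pM2l; lra.
- move=> [[i j]|]; last exact: is_derive_energy.
  by apply: is_deriveB_oy; exact: is_derive_phase.
- by move=> s s0 /=; rewrite sum_phase_constant.
- by case=> [[i j]|] //=; exact: le_trans (ler_spread _ _ _) phi0_D.
Qed.

End Solutions.

Theorem theorem1 (R : realType) (n : nat) (e : rel 'I_n)
  (K : R) (w : 'I_n -> R) (phi : R -> 'I_n -> R) (D : R) :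
  simple_graph e -> connected_graph e ->
  0 < K ->
  \sum_(i : 'I_n) w i = 0 ->
  is_solution e K w phi ->
  \sum_(i : 'I_n) phi 0 i = 0 ->
  let D0 := spread (phi 0) in
  let E0 := \sum_(i : 'I_n) phi 0 i ^+ 2 in
  let sigma := Num.sqrt (\sum_(i : 'I_n) w i ^+ 2) in
  let L := L_const R e in
  let delta := min_degree e in
  0 < D0 -> D0 <= D -> D <= pi / 2 ->
  K >= sigma * D / (Num.sqrt E0 * L * sin D) ->
  ((E0 < 3 / 4 * D ^+ 2 /\
    (forall i j : 'I_n,
       K >= n%:R * `|w i - w j| /
              (2 * delta%:R * sin (D / 2 - Num.sqrt (E0 - D ^+ 2 / 2)))))
   \/ E0 < D ^+ 2 / 2) ->
  (forall t : R, 0 <= t -> spread (phi t) <= D) /\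
  approaches phi (equilibria e K w).
Proof.
move=> e_simple e_conn K0 w0 sol sum0 D0 E0 sigma L delta.
move=> D0_gt0 D0D D_pi K_energy K_extremal.
have D_gt0 : 0 < D := lt_le_trans D0_gt0 D0D; have pi0 := pi_gt0 R.
have E0_gt0 : 0 < E0 := energy_gt0 D0_gt0.
have invariant t : 0 <= t -> spread (phi t) <= D /\ energy (phi t) <= E0.
  apply: (kuramoto_invariance e_simple K0 sol w0 D_gt0 E0_gt0) => // y.
  - move=> _ y_D y_E i j yijD.
    apply: rhs_extremal_le_threshold y_D y_E yijD; rewrite ?(ltW K0)//.
      exact: e_simple.2.
    by case: K_extremal => [[E0_lt K_ge]|]; [left; split | right].
  - move=> y0 y_D yE.
    by apply: (sum_mul_rhs_le0 e_simple (ltW K0) e_conn D_gt0);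
      rewrite ?yE//; lra.
split=> [t /invariant[]//|].
apply: (bounded_solution_approaches e_simple K0 sol) => t /invariant[_ Et] i.
exact: norm_le_sqrt_energy Et.
Qed.
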